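(* Let $x$ be a real variable. The following reduction formula holds true for $n=0,1,2,\ldots$ and $\kappa>0$: $$\mathrm{Wi}_{\kappa+n,\kappa-1/2}(x)=(-1)^n(2\kappa)_n\,2^{\kappa}\sum_{m=0}^{n}\binom{n}{m}\frac{(-2)^m}{(2\kappa)_m}\,\gamma\left(\kappa+m,\frac x2\right).$$
   Context: The integral Whittaker function is $\mathrm{Wi}_{\kappa,\mu}(x)=\int_0^x\frac{\mathrm{W}_{\kappa,\mu}(t)}{t}\,dt$, where the Whittaker function is $\mathrm{W}_{\kappa,\mu}(t)=e^{-t/2}t^{\mu+1/2}\,\mathrm{U}\left(\frac12+\mu-\kappa,1+2\mu,t\right)$ with $\mathrm{U}$ the Tricomi confluent hypergeometric function. $(\alpha)_n=\Gamma(\alpha+n)/\Gamma(\alpha)$ is the Pochhammer symbol, and $\gamma(\nu,z)=\int_0^z t^{\nu-1}e^{-t}\,dt$ ($\mathrm{Re}\,\nu>0$) is the lower incomplete gamma function. Powers and multivalued functions are taken with their principal values. *)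

(* Defs.v *)
From mathcomp Require Import all_boot all_order all_algebra.
From mathcomp Require Import all_classical all_reals all_analysis.
From mathcomp Require Import complex.

Set Implicit Arguments.
Unset Strict Implicit.
Unset Printing Implicit Defensive.

Import Order.TTheory GRing.Theory Num.Theory.
Import numFieldNormedType.Exports.

Local Open Scope classical_set_scope.
Local Open Scope ring_scope.
Local Open Scope complex_scope.

(* All parameters and arguments are real. Values are complex, because principal
   powers of negative reals are. *)

(* Principal value of t^s: Arg t = pi on the negative half-line. *)
Definition ppow (R : realType) (t s : R) : R[i] :=
  if 0 <= t then (t `^ s)%:C
  else ((- t) `^ s)%:C * (cos (pi * s) +i* sin (pi * s)).

Definition cintegral (R : realType) (D : set R) (f : R -> R[i]) : R[i] :=
  (\int[lebesgue_measure]_(t in D) complex.Re (f t))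
  +i* (\int[lebesgue_measure]_(t in D) complex.Im (f t)).

(* The oriented integral from 0 to x, for x of either sign. *)
Definition cintegral0 (R : realType) (f : R -> R[i]) (x : R) : R[i] :=
  if 0 <= x then cintegral `[0, x] f else - cintegral `[x, 0] f.

Definition clim (R : realType) (F : set_system R) (f : R -> R[i]) : R[i] :=
  lim ((fun b => complex.Re (f b)) @ F) +i* lim ((fun b => complex.Im (f b)) @ F).

(* The product a (a + 1) ... (a + s - 1). Unlike Gamma (a + s) / Gamma a it
   makes sense when a is a nonpositive integer. *)
Definition rising (R : realType) (a : R) (s : nat) : R :=
  \prod_(i < s) (a + i%:R).

Definition Gamma_pos (R : realType) (x : R) : R :=
  \int[lebesgue_measure]_(t in `]0, +oo[) (t `^ (x - 1) * expR (- t)).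

(* Euler's integral for x > 0, continued to x <= 0 by
   Gamma (x + k) = x (x + 1) ... (x + k - 1) Gamma x, with k > - x.
   At a pole the product vanishes, so the division returns 0, and then
   (Gamma x)^-1 = 0 is the correct value of the entire function 1 / Gamma. *)
Definition Gamma (R : realType) (x : R) : R :=
  if 0 < x then Gamma_pos x
  else let k := (Num.truncn (- x)).+1 in Gamma_pos (x + k%:R) / rising x k.

Definition pochhammer (R : realType) (a : R) (n : nat) : R :=
  Gamma (a + n%:R) / Gamma a.

(* Kummer's confluent hypergeometric function M(a, b, z) = 1F1(a; b; z). *)
Definition kummerM (R : realType) (a b z : R) : R :=
  limn (series (fun s : nat => rising a s / (rising b s * s`!%:R) * z ^+ s)).

(* Tricomi's formula, meaningful when b is not an integer. *)
Definition tricomiU_nonint (R : realType) (a b z : R) : R[i] :=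
  (Gamma (1 - b) / Gamma (a - b + 1) * kummerM a b z)%:C
  + (Gamma (b - 1) / Gamma a * kummerM (a - b + 1) (2 - b) z)%:C
    * ppow z (1 - b).

(* Tricomi's U(a, b, z), extended to integer b by continuity in b. *)
Definition tricomiU (R : realType) (a b z : R) : R[i] :=
  if b \is a Num.int then clim b^' (fun b' => tricomiU_nonint a b' z)
  else tricomiU_nonint a b z.

Definition whittakerW (R : realType) (kappa mu t : R) : R[i] :=
  (expR (- t / 2))%:C * ppow t (mu + 1 / 2)
  * tricomiU (1 / 2 + mu - kappa) (1 + 2 * mu) t.

Definition whittakerWi (R : realType) (kappa mu x : R) : R[i] :=
  cintegral0 (fun t => whittakerW kappa mu t / t%:C) x.

Definition lower_gamma (R : realType) (nu z : R) : R[i] :=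
  cintegral0 (fun t => ppow t (nu - 1) * (expR (- t))%:C) z.

(* Main.v *)
Require Import Defs.
From mathcomp Require Import all_boot all_order all_algebra.
From mathcomp Require Import all_classical all_reals all_analysis.
From mathcomp Require Import measurable_realfun complex.
From mathcomp Require Import zify ring lra.

(* U(-n, b, z) is the polynomial
   (-1)^n (b)_n sum_m C(n, m) (-z)^m / (b)_m: at a = -n the factor 1 / Gamma(a)
   kills the second term of Tricomi's formula, the quotient of Gamma values in
   the first one telescopes, and the result is continuous in b > 0, which covers
   integer b. Hence W_{kappa+n, kappa-1/2}(t) / t is a combination of the functions
   t^(kappa+m-1) exp(-t/2). Substituting t = x u turns every integral from 0 to x
   into one over [0, 1] and, for x of either sign, takes the principal power of x
   out of the integral; both sides of the formula then become
   x^kappa times the same combination of the real integrals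
   int_0^1 u^(kappa+m-1) exp(-x u/2) du. *)

Set Implicit Arguments.
Unset Strict Implicit.
Unset Printing Implicit Defensive.

Import Order.TTheory GRing.Theory Num.Theory.
Import numFieldNormedType.Exports.

Local Open Scope ring_scope.
Local Open Scope complex_scope.

(** * Scaling of Lebesgue integrals *)

(** Half-open intervals are the ones on which Lebesgue measure is characterised. A negative factor
    moves the open end to the other side, which leaves the length formula intact. *)
Lemma preimage_mul_itv (R : realFieldType) (c a b : R) : c != 0 ->
  ( *%R c @^-1` `]a, b])%classic =
  (if 0 < c then `]a / c, b / c]%classic else `[b / c, a / c[%classic).
Proof.
move=> c0; have [cp|cn] := ltP 0 c; apply/seteqP; split => x /=;
  rewrite !in_itv/=.
- by rewrite ltr_pdivrMr// ler_pdivlMr// mulrC.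
- by rewrite ltr_pdivrMr// ler_pdivlMr// mulrC.
- have {}cn : c < 0 by rewrite lt_neqAle c0.
  by rewrite ler_ndivrMr// ltr_ndivlMr// mulrC andbC.
- have {}cn : c < 0 by rewrite lt_neqAle c0.
  by rewrite ler_ndivrMr// ltr_ndivlMr// mulrC andbC.
Qed.

Section scaling.
Context {R : realType}.
Notation mu := (@lebesgue_measure R).
Local Open Scope ereal_scope.
Local Open Scope classical_set_scope.

(** By uniqueness of Lebesgue measure: the image measure under multiplication by [c], weighted by
    [|c|], gives every interval []a, b]] its length. *)
Lemma lebesgue_measure_scale (c : R) (A : set (measurableTypeR R)) :
  c != 0%R -> measurable A -> mu A = `|c|%:E * mu ( *%R c @^-1` A).
Proof.
move=> c0 mA.
have mc : measurable_fun [set: measurableTypeR R]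
    ( *%R c : measurableTypeR R -> measurableTypeR R).
  exact: mulrl_measurable.
pose nu := mscale (NngNum (normr_ge0 c))
  (measure_function_pushforward__canonical__measure_function_Measure mu mc).
rewrite (@lebesgue_measure_unique R nu)//=.
move=> _ [[a b] _ <-]; rewrite /nu /mscale/= /pushforward.
rewrite preimage_mul_itv//.
case: ifPn => cp.
  rewrite !lebesgue_measure_itv/= !lte_fin ltr_pM2r ?invr_gt0//.
  case: ifPn => ab; last by rewrite mule0.
  by rewrite gtr0_norm// -!EFinB -EFinM -mulrBl mulrCA mulfV// mulr1.
have {}cn : (c < 0)%R by rewrite lt_neqAle c0 leNgt.
rewrite !lebesgue_measure_itv/= !lte_fin ltr_nM2r ?invr_lt0//.
case: ifPn => ab; last by rewrite mule0.
rewrite ltr0_norm// -!EFinB -EFinM; congr EFin.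
by rewrite -mulrBl mulNr mulrCA mulfV// mulr1 opprB.
Qed.

Lemma ge0_integral_scale (c : R) (D : set (measurableTypeR R)) (f : R -> \bar R) :
  c != 0%R -> measurable D -> measurable_fun setT f -> (forall x, 0 <= f x) ->
  \int[mu]_(x in D) f x =
  `|c|%:E * \int[mu]_(x in *%R c @^-1` D) f (c * x)%R.
Proof.
move=> c0 mD mf f0.
have mc : measurable_fun [set: measurableTypeR R]
    ( *%R c : measurableTypeR R -> measurableTypeR R).
  exact: mulrl_measurable.
pose nu := mscale (NngNum (normr_ge0 c))
  (measure_function_pushforward__canonical__measure_function_Measure mu mc).
rewrite (eq_measure_integral nu); last first.
  by move=> A mA _; exact: lebesgue_measure_scale.
rewrite ge0_integral_mscale//; last exact: measurable_funTS.
rewrite ge0_integral_pushforward//; first exact: measurable_funTS.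
Qed.

Lemma integral_scale (c : R) (D : set (measurableTypeR R)) (f : R -> R) :
  c != 0%R -> measurable D -> measurable_fun setT f ->
  mu.-integrable ( *%R c @^-1` D) (fun x => (f (c * x))%:E) ->
  (\int[mu]_(x in D) f x = `|c| * \int[mu]_(x in *%R c @^-1` D) f (c * x))%R.
Proof.
move=> c0 mD mf intf.
have mcD : measurable ( *%R c @^-1` D : set (measurableTypeR R)).
  by rewrite -[X in measurable X]setTI; exact: mulrl_measurable.
rewrite -[X in (X * _)%R]/(fine `|c|%:E) /Rintegral -fineM//; last first.
  exact: (integrable_fin_num mcD intf).
congr fine; have mEf : measurable_fun setT (EFin \o f) by exact/measurable_EFinP.
rewrite [in LHS]integralE [X in _ = _ * X]integralE.
(* Distributing over the difference of the positive and negative parts needs that difference to be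
   defined; integrability makes the first term finite. *)
rewrite [RHS]muleBr//; last first.
  exact: (fin_num_adde_defr _ (integrable_pos_fin_num mcD intf)).
rewrite (ge0_integral_scale c0 mD (measurable_funepos mEf) (@funepos_ge0 _ _ _)).
rewrite (ge0_integral_scale c0 mD (measurable_funeneg mEf) (@funeneg_ge0 _ _ _)).
by congr (_ * _ - _ * _); apply: eq_integral => x _; rewrite ?funeposE ?funenegE.
Qed.
End scaling.

(** * Euler's integral *)

Section gamma_integral.
Context {R : realType}.
Notation mu := (@lebesgue_measure R).
Local Open Scope classical_set_scope.
Implicit Types x s t a b : R.

Definition gamma_density s t : R := t `^ (s - 1) * expR (- t).

Lemma gamma_density_ge0 s t : 0 <= gamma_density s t.
Proof. by rewrite mulr_ge0 ?powR_ge0 ?expR_ge0. Qed.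

Lemma measurable_gamma_density s (D : set R) :
  measurable_fun D (gamma_density s).
Proof.
apply: measurable_funTS; apply: measurable_funM; first exact: measurable_powR.
by apply: measurableT_comp => //; exact: measurable_funN.
Qed.

(** With y = t / (x + 1), the inequality y <= 1 + y <= exp y raised to the power x + 1 gives the
    bound. It makes the boundary term of the integration by parts vanish at infinity. *)
Lemma powR_expRN_le x t : 0 <= x -> 0 < t ->
  t `^ x * expR (- t) <= (x + 1) `^ (x + 1) / t.
Proof.
move=> x0 t0; have x1 : 0 < x + 1 by rewrite ltr_wpDl.
rewrite expRN ler_pdivrMr ?expR_gt0// mulrAC ler_pdivlMr//.
have -> : t `^ x * t = t `^ (x + 1).
  by rewrite powRD ?powRr1 ?ltW// (gt_eqF t0) implybT.
have -> : t `^ (x + 1) = (x + 1) `^ (x + 1) * (t / (x + 1)) `^ (x + 1).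
  by rewrite -powRM ?divr_ge0 ?(ltW t0) ?(ltW x1)// mulrC divfK// gt_eqF.
rewrite ler_wpM2l ?powR_ge0//.
have -> : expR t = (expR (t / (x + 1))) `^ (x + 1).
  by rewrite -expRM divfK// gt_eqF.
rewrite ge0_ler_powR ?nnegrE ?expR_ge0 ?divr_ge0 ?(ltW t0) ?(ltW x1)//.
by rewrite (le_trans _ (expR_ge1Dx _))// lerDr.
Qed.

Lemma within_continuous_powR x a b : 0 < a ->
  {within `[a, b], continuous (@powR R ^~ x)}.
Proof.
move=> a0; apply: derivable_within_continuous => y; rewrite in_itv/= => /andP[ay _].
by apply: derivable_powR; rewrite in_itv/= andbT (lt_le_trans a0).
Qed.

Lemma is_derive_expRN (y : R) : is_derive y 1 (fun t => - expR (- t)) (expR (- y)).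
Proof.
apply: is_derive_eq.
by rewrite mulrN1 opprK.
Qed.

(** Staying away from 0 avoids the singularity of the density. The boundary terms are added on
    opposite sides, so that all terms are nonnegative for x > 0 and the limit can be taken in the
    extended reals before finiteness is known. *)
Lemma gamma_by_parts x a b : 0 < a -> a < b ->
  (\int[mu]_(t in `[a, b]) (gamma_density (x + 1) t)%:E
    + (b `^ x * expR (- b))%:E =
   (a `^ x * expR (- a))%:E
    + x%:E * \int[mu]_(t in `[a, b]) (gamma_density x t)%:E)%E.
Proof.
move=> a0 ab.
have cexp : continuous (fun t : R => expR (- t)).
  by move=> t; apply: continuous_comp; [exact: continuousN|exact: continuous_expR].
have cpow y : {within `[a, b], continuous (@powR R ^~ y)}.
  exact: within_continuous_powR.
have cg s : mu.-integrable `[a, b] (EFin \o gamma_density s).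
  apply: continuous_compact_integrable; first exact: segment_compact.
  move=> t; apply: cvgM; first exact: cpow.
  by apply: continuous_subspaceT => // t'; exact: cexp.
have b0 : 0 < b by exact: lt_trans ab.
have cpt (y t : R) : 0 < t -> {for t, continuous (@powR R ^~ y)}.
  move=> t0; apply: differentiable_continuous; apply/derivable1_diffP.
  by apply: derivable_powR; rewrite in_itv/= andbT.
have := @integration_by_parts R (@powR R ^~ x) (fun t => - expR (- t))
  (fun t => x * t `^ (x - 1)) (fun t => expR (- t)) a b ab.
move=> H.
have {H} -> // : (\int[mu]_(t in `[a, b]) (gamma_density (x + 1) t)%:E =
   (b `^ x * - expR (- b) - a `^ x * - expR (- a))%:E -
   \int[mu]_(t in `[a, b]) (x * t `^ (x - 1) * - expR (- t))%:E)%E.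
  rewrite -H.
  - by apply: eq_integral => t _; rewrite /gamma_density addrK.
  - move=> t; apply: cvgM; first exact: cvg_cst.
    exact: cpow.
  - split.
    + move=> t; rewrite in_itv/= => /andP[at_ _].
      by apply: derivable_powR; rewrite in_itv/= andbT (lt_trans a0).
    + by apply: cvg_at_right_filter; exact: cpt.
    + by apply: cvg_at_left_filter; exact: cpt.
  - move=> t; rewrite in_itv/= => /andP[at_ _].
    by rewrite powR_derive1// in_itv/= andbT (lt_trans a0).
  - by apply: continuous_subspaceT => t; exact: cexp.
  - split.
    + by move=> t _; case: (is_derive_expRN t).
    + by apply: cvg_at_right_filter; apply: cvgN; exact: cexp.
    + by apply: cvg_at_left_filter; apply: cvgN; exact: cexp.
  - by move=> t _; rewrite derive1E; case: (is_derive_expRN t).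
have -> : (\int[mu]_(t in `[a, b]) (x * t `^ (x - 1) * - expR (- t))%:E =
    (- x)%:E * \int[mu]_(t in `[a, b]) (gamma_density x t)%:E)%E.
  rewrite -integralZl//; last exact: cg.
  apply: eq_integral => t _.
  by rewrite -EFinM /gamma_density mulrN mulNr mulrA.
have /fineK <- :
    (\int[mu]_(t in `[a, b]) (gamma_density x t)%:E)%E \is a fin_num.
  by apply: integrable_fin_num => //; exact: cg.
rewrite -!EFinM -EFinB -!EFinD; congr EFin; ring.
Qed.

End gamma_integral.

(** * Convergence, functional equation and positivity of Euler's integral *)

Section gamma_function.
Context {R : realType}.
Notation mu := (@lebesgue_measure R).
Local Open Scope classical_set_scope.
Local Open Scope ereal_scope.
Implicit Types x s t a b : R.

(** Starting from 2 keeps the left endpoint strictly below the right one, as integration by parts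
    requires. *)
Let bulk n : set R := `[n.+2%:R^-1%R, n.+2%:R%R].

Lemma bigcup_itv_oy :
  \bigcup_n bulk n = `]0%R, +oo[ :> set R.
Proof.
apply/seteqP; split => [t [n _]|t] /=.
  rewrite /bulk/= !in_itv/= andbT => /andP[nt _].
  by rewrite (lt_le_trans _ nt)// invr_gt0.
rewrite in_itv/= andbT => t0.
pose N := maxn (Num.truncn t) (Num.truncn t^-1).
exists N => //; rewrite /bulk/= in_itv/=; apply/andP; split.
  rewrite invf_ple ?posrE//; apply/ltW/(lt_le_trans (truncnS_gt _)).
  by rewrite ler_nat ltnS leqW// leq_maxr.
apply/ltW/(lt_le_trans (truncnS_gt _)).
by rewrite ler_nat ltnS leqW// leq_maxl.
Qed.

(** Monotone convergence along the increasing segments [bulk n]; the limit may a priori be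
    infinite. *)
Lemma cvg_gamma_integral s :
  \int[mu]_(t in bulk n) (gamma_density s t)%:E
    @[n --> \oo] --> \int[mu]_(t in `]0%R, +oo[) (gamma_density s t)%:E.
Proof.
rewrite -bigcup_itv_oy; apply: ge0_nondecreasing_set_cvg_integral.
- move=> m n mn; apply/subsetPset => t; rewrite /bulk/= !in_itv/= => /andP[mt tm].
  apply/andP; split.
    by rewrite (le_trans _ mt)// lef_pV2 ?posrE// ler_nat !ltnS.
  by rewrite (le_trans tm)// ler_nat !ltnS.
- by move=> n; exact: measurable_itv.
- by move=> n; apply/measurable_EFinP; exact: measurable_gamma_density.
- by move=> n t _; rewrite lee_fin gamma_density_ge0.
Qed.

Lemma gamma_integral_ge0 s (D : set R) :
  0 <= \int[mu]_(t in D) (gamma_density s t)%:E.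
Proof. by apply: integral_ge0 => t _; rewrite lee_fin gamma_density_ge0. Qed.

(** Limit of [gamma_by_parts] over [bulk n]. It holds in the extended reals, and can therefore serve
    in the proof that the integrals are finite. *)
Lemma gamma_integral_rec x : (0 < x)%R ->
  \int[mu]_(t in `]0%R, +oo[) (gamma_density (x + 1) t)%:E =
  x%:E * \int[mu]_(t in `]0%R, +oo[) (gamma_density x t)%:E.
Proof.
move=> x0.
have inv0 : (n.+2%:R^-1 : R)%R @[n --> \oo] --> 0%R.
  by have := @cvg_harmonic R; rewrite -cvg_shiftS.
pose bd t : \bar R := (t `^ x * expR (- t))%:E.
(* Near 0 the boundary term is at most t^x, which tends to 0 because x > 0. *)
have bdinv : bd n.+2%:R^-1%R @[n --> \oo] --> 0.
  apply/fine_cvgP; split; first by near=> n.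
  apply: (@squeeze_cvgr _ _ _ _ (cst 0%R) (fun n => n.+2%:R^-1 `^ x)%R).
  - near=> n; rewrite /bd/= mulr_ge0 ?powR_ge0 ?expR_ge0//=.
    by rewrite ler_piMr ?powR_ge0// expR_le1 oppr_le0.
  - exact: cvg_cst.
  - by move/cvg_at_rightP : (powR_cvg0 x0); apply; split => // n; rewrite invr_gt0.
have bdy : bd n.+2%:R%R @[n --> \oo] --> 0.
  apply/fine_cvgP; split; first by near=> n.
  apply: (@squeeze_cvgr _ _ _ _ (cst 0%R) (fun n => ((x + 1) `^ (x + 1) / n.+2%:R)%R)).
  - near=> n; rewrite /bd/= mulr_ge0 ?powR_ge0 ?expR_ge0//=.
    by rewrite powR_expRN_le// ltW.
  - exact: cvg_cst.
  - by rewrite -[X in _ --> X](mulr0 ((x + 1) `^ (x + 1))%R); apply: cvgZr.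
have L : (\int[mu]_(t in bulk n) (gamma_density (x + 1) t)%:E
    + bd n.+2%:R%R) @[n --> \oo] -->
    \int[mu]_(t in `]0%R, +oo[) (gamma_density (x + 1) t)%:E + 0.
  apply: cvgeD => //; last exact: cvg_gamma_integral.
  by rewrite fin_num_adde_defl.
have Rr : (bd n.+2%:R^-1%R + x%:E *
    \int[mu]_(t in bulk n) (gamma_density x t)%:E)
    @[n --> \oo] -->
    0 + x%:E * \int[mu]_(t in `]0%R, +oo[) (gamma_density x t)%:E.
  apply: cvgeD => //; last by apply: cvgeZl => //; exact: cvg_gamma_integral.
rewrite -[LHS]adde0 -[RHS]add0e; apply: cvg_unique L _ => //.
apply: cvg_trans Rr; apply: near_eq_cvg; near=> n.
rewrite /bd gamma_by_parts//.
rewrite (@lt_trans _ _ 1%R) ?invf_lt1 ?ltr1n//.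
Unshelve. all: by end_near. Qed.

Lemma gamma_integral1 :
  \int[mu]_(t in `]0%R, +oo[) (gamma_density 1 t)%:E < +oo.
Proof.
apply: (@le_lt_trans _ _ (\int[mu]_(t in `[0%R, +oo[) (expR (- t))%:E)).
  under eq_integral do rewrite /gamma_density subrr powRr0 mul1r.
  apply: ge0_subset_integral => //=.
  - apply/measurable_EFinP/measurableT_comp => //.
  - by move=> t /=; rewrite !in_itv/= !andbT => /ltW.
rewrite (@ge0_continuous_FTC2y _ _ (fun t => - expR (- t))%R _ 0%R)//.
- by rewrite -EFinB ltry.
- apply: continuous_subspaceT => t.
  by apply: continuous_comp; [exact: continuousN|exact: continuous_expR].
- by rewrite -[X in _ --> X]oppr0; apply: cvgN; exact: cvgr_expR.
- apply: cvg_at_right_filter; apply: cvgN.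
  by apply: continuous_comp; [exact: continuousN|exact: continuous_expR].
- by move=> t _; rewrite derive1E; case: (is_derive_expRN t).
Qed.

Lemma gamma_integral_nat n :
  \int[mu]_(t in `]0%R, +oo[) (gamma_density n.+1%:R t)%:E < +oo.
Proof.
elim: n => [|n IH]; first exact: gamma_integral1.
rewrite -[n.+2%:R]natr1 gamma_integral_rec// lte_mul_pinfty//.
Qed.

(** For x < n one has t^x <= 1 + t^n, so the integral at x + 1 is bounded by those at the integers 1
    and n + 1. The recurrence then brings finiteness down to x, where the density may be unbounded
    near 0. *)
Lemma gamma_integral_lty x : (0 < x)%R ->
  \int[mu]_(t in `]0%R, +oo[) (gamma_density x t)%:E < +oo.
Proof.
move=> x0; have [n xn] : exists n, (x < n%:R)%R.
  by exists (Num.truncn x).+1; exact: truncnS_gt.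
have : \int[mu]_(t in `]0%R, +oo[) (gamma_density (x + 1) t)%:E < +oo.
  apply: (@le_lt_trans _ _ (\int[mu]_(t in `]0%R, +oo[)
    ((gamma_density 1 t)%:E + (gamma_density n.+1%:R t)%:E))).
    apply: ge0_le_integral => //.
    - by move=> t _; rewrite lee_fin gamma_density_ge0.
    - by apply/measurable_EFinP; exact: measurable_gamma_density.
    - by apply: emeasurable_funD; apply/measurable_EFinP; exact: measurable_gamma_density.
    move=> t; rewrite /= in_itv/= andbT => t0; rewrite -EFinD lee_fin.
    rewrite /gamma_density -mulrDl ler_wpM2r ?expR_ge0//.
    rewrite addrK subrr powRr0 -natr1 addrK.
    have [t1|t1] := leP t 1%R.
      by rewrite ler_wpDr ?powR_ge0// -(powRr0 t) ger_powR ?t0 ?t1 ?ltW.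
    by rewrite ler_wpDl// ler_powR ?ltW.
  rewrite ge0_integralD//.
  - exact: (lte_add_pinfty gamma_integral1 (gamma_integral_nat n)).
  - by move=> t _; rewrite lee_fin gamma_density_ge0.
  - by apply/measurable_EFinP; exact: measurable_gamma_density.
  - by move=> t _; rewrite lee_fin gamma_density_ge0.
  - by apply/measurable_EFinP; exact: measurable_gamma_density.
(* An infinite integral at x would stay infinite after multiplication by x > 0. *)
rewrite gamma_integral_rec//; have := gamma_integral_ge0 x `]0%R, +oo[.
case: (\int[mu]_(t in _) _) => [r _ _|_|_]; [exact: ltry| |by []].
by rewrite gt0_muley// lte_fin.
Qed.

Lemma gamma_density_integrable x : (0 < x)%R ->
  mu.-integrable `]0%R, +oo[ (fun t => (gamma_density x t)%:E).
Proof.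
move=> x0; apply/integrableP; split.
  by apply/measurable_EFinP; exact: measurable_gamma_density.
under eq_integral do rewrite gee0_abs ?lee_fin ?gamma_density_ge0//.
exact: gamma_integral_lty.
Qed.

Lemma Gamma_posE x : (0 < x)%R ->
  (Gamma_pos x)%:E = \int[mu]_(t in `]0%R, +oo[) (gamma_density x t)%:E.
Proof.
by move=> x0; rewrite fineK// integrable_fin_num//; exact: gamma_density_integrable.
Qed.

Local Open Scope ring_scope.

Lemma Gamma_posS x : 0 < x -> Gamma_pos (x + 1) = x * Gamma_pos x.
Proof.
move=> x0; have x1 : 0 < x + 1 by rewrite addr_gt0.
apply: EFin_inj; rewrite EFinM (Gamma_posE x1) (Gamma_posE x0).
exact: gamma_integral_rec.
Qed.

(** The functional equation moves the question to x + 1, where the exponent x is positive and the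
    density is at least exp(-2) on [1, 2]. *)
Lemma Gamma_pos_gt0 x : 0 < x -> 0 < Gamma_pos x.
Proof.
move=> x0; have x1 : 0 < x + 1 by rewrite addr_gt0.
rewrite -(pmulr_rgt0 _ x0) -(Gamma_posS x0) -lte_fin (Gamma_posE x1).
apply: (@lt_le_trans _ _ (\int[mu]_(t in `[1%R, 2%R]) (expR (- 2))%:E)%E).
  rewrite integral_cst//= lebesgue_measure_itv/= lte_fin ltr1n -EFinB -EFinM.
  by rewrite lte_fin mulr_gt0 ?expR_gt0// subr_gt0 ltr1n.
apply: (@le_trans _ _ (\int[mu]_(t in `[1%R, 2%R]) (gamma_density (x + 1) t)%:E)%E).
  apply: ge0_le_integral => //=.
  - by apply/measurable_EFinP; exact: measurable_gamma_density.
  - move=> t; rewrite in_itv/= => /andP[t1 t2]; rewrite lee_fin /gamma_density.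
    rewrite addrK -[leLHS]mul1r ler_pM ?expR_ge0 ?ler_expR ?lerN2//.
    by rewrite -(powRr0 t) ler_powR// ltW.
apply: ge0_subset_integral => //=.
- by apply/measurable_EFinP; exact: measurable_gamma_density.
- by move=> t _; rewrite lee_fin gamma_density_ge0.
- by move=> t /=; rewrite !in_itv/= andbT => /andP[/(lt_le_trans ltr01)].
Qed.

End gamma_function.

(** * Tricomi's function at a = -n *)

Section rising_factorial.
Context {R : realType}.
Local Open Scope classical_set_scope.
Implicit Types (a b x z : R) (m n s : nat).

Lemma risingS a n : rising a n.+1 = rising a n * (a + n%:R).
Proof. by rewrite /rising big_ord_recr. Qed.

Lemma rising0 a : rising a 0 = 1.
Proof. by rewrite /rising big_ord0. Qed.

Lemma risingD a m n : rising a (m + n) = rising a m * rising (a + m%:R) n.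
Proof.
elim: n => [|n IH]; first by rewrite addn0 rising0 mulr1.
by rewrite addnS !risingS IH -mulrA natrD addrA.
Qed.

Lemma rising_neq0 a n : (forall i, a + i%:R != 0) -> rising a n != 0.
Proof. by move=> a0; apply/prodf_neq0 => i _. Qed.

Lemma rising_gt0 a n : 0 < a -> 0 < rising a n.
Proof. by move=> a0; apply: prodr_gt0 => i _; rewrite ltr_wpDr. Qed.

Lemma risingN_nat n s : rising (- n%:R) s = (-1) ^+ s * (n ^_ s)%:R :> R.
Proof.
elim: s => [|s IH]; first by rewrite rising0 ffactn0 mulr1.
rewrite risingS IH ffactnSr natrM exprS; have [sn|ns] := leqP s n.
  by rewrite natrB//; ring.
by rewrite ffact_small// !(mulr0, mul0r).
Qed.

(** Reversing the order of the factors turns each of them into -(b + i). *)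
Lemma rising_reflect b n : rising (1 - b - n%:R) n = (-1) ^+ n * rising b n.
Proof.
rewrite /rising (reindex_inj rev_ord_inj)/=.
have -> : (-1) ^+ n = \prod_(i < n) (-1) :> R by rewrite prodr_const card_ord.
rewrite -big_split/=; apply: eq_bigr => i _.
by rewrite natrB// -natr1; ring.
Qed.

Lemma rising_continuous n : continuous (fun b => rising b n).
Proof.
elim: n => [|n IH] b.
  rewrite (_ : (fun _ => _) = cst 1); first exact: cvg_cst.
  by apply/funext => ?; rewrite rising0.
rewrite (_ : (fun _ => _) = (fun b => rising b n * (b + n%:R))); last first.
  by apply/funext => ?; rewrite risingS.
apply: cvgM; first exact: IH.
by apply: cvgD; [exact: cvg_id|exact: cvg_cst].
Qed.

End rising_factorial.

(** * Quotients of Gamma values away from the poles *)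

Section gamma_quotients.
Context {R : realType}.
Implicit Types (x y : R) (k n : nat).

Lemma Gamma_posD x n : 0 < x ->
  Gamma_pos (x + n%:R) = rising x n * Gamma_pos x.
Proof.
move=> x0; elim: n => [|n IH]; first by rewrite addr0 rising0 mul1r.
by rewrite -natr1 addrA Gamma_posS ?ltr_wpDr// IH risingS; ring.
Qed.

(** The definition of [Gamma] fixes one number of shifts. Away from the poles any k reaching the
    positive half-line gives the same value, so that two Gamma values can be compared through a
    common argument. *)
Lemma Gamma_pos_shift y k : (forall i, y + i%:R != 0) -> 0 < y + k%:R ->
  Gamma y = Gamma_pos (y + k%:R) / rising y k.
Proof.
move=> y0 yk.
have shift m n : 0 < y + m%:R ->
    Gamma_pos (y + (m + n)%:R) / rising y (m + n) =
    Gamma_pos (y + m%:R) / rising y m.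
  move=> ym; rewrite natrD addrA (Gamma_posD n ym) risingD; field.
  by rewrite !rising_neq0// => i; rewrite -addrA -natrD.
rewrite /Gamma; case: ifPn => [yp|].
  by have := shift 0%N k; rewrite add0n addr0 rising0 divr1 => ->.
rewrite -leNgt => _; set m := _.+1.
have ym : 0 < y + m%:R.
  by rewrite -(opprK y) addrC subr_gt0 truncnS_gt.
(* Whichever of k and m is larger is written as the smaller one plus extra shifts. *)
have [/subnK <-|/ltnW/subnK <-] := leqP k m.
  by rewrite addnC shift.
by rewrite [in RHS]addnC shift.
Qed.

Lemma Gamma_neq0 y : (forall i, y + i%:R != 0) -> Gamma y != 0.
Proof.
move=> y0; pose k := (Num.truncn `|y|).+1.
have yk : 0 < y + k%:R.
  rewrite -ltrBlDl sub0r (le_lt_trans _ (truncnS_gt _))//.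
  by rewrite -normrN ler_norm.
rewrite (@Gamma_pos_shift _ k)// mulf_neq0 ?invr_neq0 ?rising_neq0//.
by rewrite gt_eqF// Gamma_pos_gt0.
Qed.

(** Both Gamma values are expressed through [Gamma_pos] at y + n + k, which cancels. Negative y must
    be covered too, since Tricomi's formula calls for y = 1 - b - n. *)
Lemma pochhammerE y n : (forall i, y + i%:R != 0) ->
  pochhammer y n = rising y n.
Proof.
(* This k exceeds |y|, so y + k is positive whatever the sign of y. *)
move=> y0; pose k := (Num.truncn `|y|).+1.
have yk : 0 < y + k%:R.
  rewrite -ltrBlDl sub0r (le_lt_trans _ (truncnS_gt _))//.
  by rewrite -normrN ler_norm.
have ynk : 0 < y + n%:R + k%:R by rewrite addrAC ltr_wpDr.
have yn0 i : y + n%:R + i%:R != 0 by rewrite -addrA -natrD.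
apply/(canLR (mulfK (Gamma_neq0 y0))).
rewrite (@Gamma_pos_shift _ k)// (@Gamma_pos_shift y (n + k))//; last first.
  by rewrite natrD addrA.
rewrite risingD natrD addrA mulrCA; congr (_ * _).
by rewrite invfM mulrA mulfV ?mul1r// rising_neq0.
Qed.

(* The value 0 that [Gamma] takes at its poles. *)
Lemma Gamma_Nnat n : Gamma (- n%:R) = 0 :> R.
Proof.
rewrite /Gamma oppr_gt0 ltrn0 opprK natrK risingN_nat ffact_small//.
by rewrite mulr0 invr0 mulr0.
Qed.

End gamma_quotients.

(** * Reduction of Tricomi's function to a Laguerre polynomial *)

Section tricomi.
Context {R : realType}.
Local Open Scope classical_set_scope.
Implicit Types (b z : R) (n : nat).

(* Equal to (-1)^n n! L_n^(b-1)(z), with L_n^(b-1) the Laguerre polynomial. *)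
Definition laguerre n b z : R :=
  (-1) ^+ n * rising b n * \sum_(m < n.+1) 'C(n, m)%:R * (- z) ^+ m / rising b m.

(** The factor (-n)_m vanishes for m > n, so the partial sums are constant from index n + 1 on; for
    the other m, (-n)_m / m! is a signed binomial coefficient. *)
Lemma kummerM_Nnat n b z : kummerM (- n%:R) b z =
  \sum_(m < n.+1) 'C(n, m)%:R * (- z) ^+ m / rising b m.
Proof.
rewrite /kummerM; apply: lim_near_cst => //; exists n.+1 => //= k /= nk.
rewrite /series/= (big_cat_nat (leq0n n.+1) nk)//= [X in _ + X]big1_seq ?addr0; last first.
  move=> m; rewrite mem_index_iota => /andP[_ /andP[nm _]].
  by rewrite risingN_nat ffact_small// mulr0 !mul0r.
rewrite big_mkord; apply: eq_bigr => m _.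
rewrite risingN_nat -bin_ffact natrM invfM [in RHS]exprNn.
have m0 : m`!%:R != 0 :> R by rewrite pnatr_eq0 -lt0n fact_gt0.
rewrite [LHS](_ : _ = 'C(n, m)%:R * ((-1) ^+ m * z ^+ m) / rising b m *
  (m`!%:R / m`!%:R)); last by ring.
by rewrite divff// mulr1.
Qed.

Lemma tricomiU_nonint_Nnat n b z : b \isn't a Num.int ->
  tricomiU_nonint (- n%:R) b z = (laguerre n b z)%:C.
Proof.
move=> bint; rewrite /tricomiU_nonint Gamma_Nnat invr0 mulr0 mul0r mul0r addr0.
rewrite kummerM_Nnat /laguerre -rising_reflect; congr ((_ * _)%:C).
(* As b is not an integer, 1 - b - n is not a pole of Gamma and the product is a genuine Gamma
   quotient. *)
have <- : pochhammer (1 - b - n%:R) n = rising (1 - b - n%:R) n.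
  apply: pochhammerE => i; apply: contra bint => /eqP h.
  have -> : b = 1 - n%:R + i%:R by move: h; lra.
  by rewrite rpredD ?rpredB ?rpred1 ?rpred_nat.
by rewrite /pochhammer; congr (Gamma _ / Gamma _); ring.
Qed.

Lemma laguerre_continuous n z b : 0 < b -> {for b, continuous (laguerre n ^~ z)}.
Proof.
move=> b0; apply: cvgM.
  by apply: cvgM; [exact: cvg_cst|exact: rising_continuous].
apply: cvg_big => [|m _]; first exact: add_continuous.
apply: cvgM; first exact: cvg_cst.
by apply: cvgV; [rewrite gt_eqF// rising_gt0|exact: rising_continuous].
Qed.

(** Distinct integers are at distance at least 1. Hence the punctured limit defining U at an integer
    b only sees values b' where the non-integer formula applies. *)
Lemma near_nonint b : \forall b' \near b^', b \is a Num.int -> b' \isn't a Num.int.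
Proof.
rewrite near_withinE; near=> b' => b'b /intrP[p bp].
apply: contraNN b'b => /intrP[q b'q]; rewrite b'q bp eqr_int.
have : `|b - b'| < 1.
  by near: b'; apply: cvgr_dist_lt ltr01; exact: cvg_id.
rewrite bp b'q -intrB -intr_norm -[1]/(1%:~R) ltr_int.
by rewrite distrC; move: p q {bp b'q} => p q; lia.
Unshelve. all: by end_near. Qed.

Lemma tricomiU_Nnat n b z : 0 < b ->
  tricomiU (- n%:R) b z = (laguerre n b z)%:C.
Proof.
move=> b0; rewrite /tricomiU; case: ifPn => [bint|]; last first.
  exact: tricomiU_nonint_Nnat.
have eqU : \forall b' \near b^',
    tricomiU_nonint (- n%:R) b' z = (laguerre n b' z)%:C.
  by apply: filterS (near_nonint b) => b' /(_ bint); exact: tricomiU_nonint_Nnat.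
have L : laguerre n b' z @[b' --> b^'] --> laguerre n b z.
  by apply: cvg_within_filter; exact: laguerre_continuous.
rewrite /clim; congr (_ +i* _); apply: cvg_lim => //.
  apply: cvg_trans L; apply: near_eq_cvg; apply: filterS eqU => b' -> //.
(* The imaginary part is identically 0 near b, as the polynomial is real. *)
have L0 : cst (0 : R) b' @[b' --> b^'] --> (0 : R) by exact: cvg_cst.
apply: cvg_trans L0; apply: near_eq_cvg; apply: filterS eqU => b' -> //.
Qed.

End tricomi.

(** * Integrals of principal powers *)

Section principal_power.
Context {R : realType}.
Implicit Types (s t u : R) (n : nat).

(** A positive factor does not change the argument of t, so the branch is preserved. *)
Lemma ppowM u t s : 0 <= u -> ppow (u * t) s = (u `^ s)%:C * ppow t s.
Proof.
rewrite le_eqVlt => /predU1P[<-|u0].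
  (* At u = 0 the convention 0^0 = 1 matters: for s = 0 every principal power is 1, otherwise both
     sides are 0. *)
  rewrite mul0r /ppow lexx; have [->|s0] := eqVneq s 0.
    rewrite !powRr0 mulr0 cos0 sin0 -[1 +i* 0]/(1%:C) rmorph1 !mulr1.
    by rewrite if_same mulr1.
  by rewrite powR0// mul0r.
rewrite /ppow pmulr_rge0//; case: ifPn => t0; first by rewrite (powRM _ (ltW u0) t0) rmorphM.
have tn : 0 <= - t by rewrite oppr_ge0 ltW// ltNge.
by rewrite -mulrN (powRM _ (ltW u0) tn) rmorphM mulrA.
Qed.

(** For negative t, adding 1 to s contributes exp(i pi) = -1, which turns the factor -t into t. At t
    = 0 the identity fails for s = -1, because 0^0 = 1. *)
Lemma ppowD1 t s : t != 0 -> ppow t (s + 1) = ppow t s * t%:C.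
Proof.
move=> t0; rewrite /ppow; case: ifPn => [tge0|].
  by rewrite powRD ?powRr1 ?rmorphM ?t0 ?implybT.
rewrite -ltNge => tlt0; rewrite powRD ?oppr_eq0 ?t0 ?implybT//.
rewrite powRr1 ?oppr_ge0 ?ltW// mulrDr mulr1 cosDpi sinDpi.
by apply/eqP; rewrite eq_complex/=; apply/andP; split; apply/eqP; ring.
Qed.

Lemma ppowDn t s n : t != 0 -> ppow t (s + n%:R) = ppow t s * (t ^+ n)%:C.
Proof.
move=> t0; elim: n => [|n IH]; first by rewrite addr0 expr0 mulr1.
by rewrite -natr1 addrA ppowD1// IH exprSr rmorphM mulrA.
Qed.

Lemma measurable_Re_ppow s : measurable_fun setT (fun t => complex.Re (ppow t s)).
Proof.
rewrite (_ : (fun _ => _) =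
    fun t => if 0 <= t then t `^ s else (- t) `^ s * cos (pi * s)); last first.
  by apply/funext => t; rewrite /ppow; case: ifPn => //= _; rewrite mul0r subr0.
apply: measurable_fun_ifT.
- exact: measurable_fun_ler.
- exact: measurable_powR.
- apply: measurable_funM => //.
  apply: (measurableT_comp (measurable_powR s)); exact: oppr_measurable.
Qed.

Lemma measurable_Im_ppow s : measurable_fun setT (fun t => complex.Im (ppow t s)).
Proof.
rewrite (_ : (fun _ => _) =
    fun t => if 0 <= t then 0 else (- t) `^ s * sin (pi * s)); last first.
  by apply/funext => t; rewrite /ppow; case: ifPn => //= _; rewrite mul0r addr0.
apply: measurable_fun_ifT.
- exact: measurable_fun_ler.
- exact: measurable_cst.
- apply: measurable_funM => //.
  apply: (measurableT_comp (measurable_powR s)); exact: oppr_measurable.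
Qed.

End principal_power.

(** * Complex integrals from 0 to x rescaled to the unit segment *)

Section complex_integral.
Context {R : realType}.
Local Open Scope classical_set_scope.
Notation mu := (@lebesgue_measure R).
Implicit Types (x s t u : R).

Let measurable_unit_segment : measurable (`[0, 1] : set (measurableTypeR R)).
Proof. by []. Qed.

Lemma ReM_realr (z : R[i]) t : complex.Re (z * t%:C) = complex.Re z * t.
Proof. by case: z => a b /=; rewrite mulr0 subr0. Qed.

Lemma ImM_realr (z : R[i]) t : complex.Im (z * t%:C) = complex.Im z * t.
Proof. by case: z => a b /=; rewrite mulr0 add0r. Qed.

Lemma cintegralZ (D : set R) (z : R[i]) (h : R -> R) :
  measurable D -> mu.-integrable D (EFin \o h) ->
  cintegral D (fun u => z * (h u)%:C) = z * (\int[mu]_(u in D) h u)%:C.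
Proof.
move=> mD ih; rewrite /cintegral.
under eq_Rintegral do rewrite ReM_realr.
under [X in _ +i* X]eq_Rintegral do rewrite ImM_realr.
rewrite !RintegralZl//.
by case: z => a b; simpc.
Qed.

Lemma preimage_mul_segment x : x != 0 ->
  *%R x @^-1` (if 0 <= x then `[0, x] else `[x, 0]) = `[0, 1] :> set R.
Proof.
move=> x0; apply/seteqP; split => u; case: ifPn => xs /=; rewrite !in_itv/=.
- have xp : 0 < x by rewrite lt_neqAle eq_sym x0.
  by have := ler_pM2l xp u 1; rewrite pmulr_rge0// mulr1 => ->.
- have xn : x < 0 by rewrite ltNge.
  by have := ler_nM2l xn 1 u; rewrite nmulr_rle0// mulr1 => ->; rewrite andbC.
- have xp : 0 < x by rewrite lt_neqAle eq_sym x0.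
  by have := ler_pM2l xp u 1; rewrite pmulr_rge0// mulr1 => ->.
- have xn : x < 0 by rewrite ltNge.
  by have := ler_nM2l xn 1 u; rewrite nmulr_rle0// mulr1 => ->; rewrite andbC.
Qed.

(** The orientation contributes the sign of x and the substitution t = x u contributes |x|; together
    they give x. *)
Lemma cintegral0_scale (f : R -> R[i]) x :
  measurable_fun setT (fun t => complex.Re (f t)) ->
  measurable_fun setT (fun t => complex.Im (f t)) ->
  mu.-integrable `[0, 1] (fun u => (complex.Re (f (x * u)))%:E) ->
  mu.-integrable `[0, 1] (fun u => (complex.Im (f (x * u)))%:E) ->
  cintegral0 f x = x%:C * cintegral `[0, 1] (fun u => f (x * u)).
Proof.
move=> mRe mIm iRe iIm; have [->|x0] := eqVneq x 0.
  by rewrite /cintegral0 lexx mul0r set_itv1 /cintegral !Rintegral_set1.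
have scale (g : R -> R) : measurable_fun setT g ->
    mu.-integrable `[0, 1] (fun u => (g (x * u))%:E) ->
    \int[mu]_(t in if 0 <= x then `[0, x] else `[x, 0]) g t =
    `|x| * \int[mu]_(u in `[0, 1]) g (x * u).
  move=> mg ig; rewrite (integral_scale x0)//; first by rewrite preimage_mul_segment.
  - by case: ifPn.
  - by rewrite preimage_mul_segment.
have -> : cintegral0 f x = (Num.sg x)%:C *
    cintegral (if 0 <= x then `[0, x] else `[x, 0]) f.
  rewrite /cintegral0; case: ifPn => xs; last first.
    by rewrite ltr0_sg ?ltNge// rmorphN1 mulN1r.
  by rewrite gtr0_sg ?mul1r// lt_neqAle eq_sym x0.
rewrite /cintegral (scale _ mRe iRe) (scale _ mIm iIm).
set a := Rintegral _ _ _; set b := Rintegral _ _ _.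
by rewrite [x in RHS]numEsg; simpc; rewrite !mulrA.
Qed.

Lemma cintegral0_ppow s (r : R -> R) x : measurable_fun setT r ->
  mu.-integrable `[0, 1] (fun u => (u `^ s * r (x * u))%:E) ->
  cintegral0 (fun t => ppow t s * (r t)%:C) x =
  x%:C * ppow x s * (\int[mu]_(u in `[0, 1]) (u `^ s * r (x * u)))%:C.
Proof.
move=> mr ir.
have fE u : 0 <= u -> ppow (x * u) s * (r (x * u))%:C =
    ppow x s * (u `^ s * r (x * u))%:C.
  by move=> u0; rewrite [in ppow _ _]mulrC ppowM// rmorphM mulrCA mulrA.
(* Here [part] stands for the real or the imaginary part, so that one argument serves both. *)
have ifx (part : R[i] -> R) : (forall w t, part (w * t%:C) = part w * t) ->
    mu.-integrable `[0, 1]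
      (fun u => (part (ppow (x * u) s * (r (x * u))%:C))%:E).
  move=> partM; have := integrableZl measurable_unit_segment (part (ppow x s)) ir.
  apply: eq_integrable => // u; rewrite inE/= in_itv/= => /andP[u0 _].
  by rewrite fE// partM EFinM.
rewrite cintegral0_scale.
- rewrite -mulrA -cintegralZ//; congr (_ * _).
  rewrite /cintegral; congr (_ +i* _); apply: eq_Rintegral => u;
  by rewrite inE/= in_itv/= => /andP[u0 _]; rewrite fE.
- under eq_fun do rewrite ReM_realr.
  by apply: measurable_funM => //; exact: measurable_Re_ppow.
- under eq_fun do rewrite ImM_realr.
  by apply: measurable_funM => //; exact: measurable_Im_ppow.
- by apply: ifx => w t; exact: ReM_realr.
- by apply: ifx => w t; exact: ImM_realr.
Qed.

(** Dividing out powers of u alters the integrand at u = 0 through the default values of inverses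
    and powers. That point is null, so agreement on []0, 1]] suffices. *)
Lemma integrable_unit_segment (f g : R -> R) : measurable_fun setT f ->
  {in `]0, 1], f =1 g} ->
  mu.-integrable `[0, 1] (EFin \o g) -> mu.-integrable `[0, 1] (EFin \o f).
Proof.
move=> mf fg ig; have mEf (D : set R) : measurable_fun D (EFin \o f).
  by apply/measurable_EFinP; exact: measurable_funTS.
apply/integrableP; split; first exact: mEf.
rewrite -integral_itv_obnd_cbnd; last by apply: measurableT_comp => //; exact: mEf.
have /integrableP[_] // : mu.-integrable `]0, 1] (EFin \o f).
apply: eq_integrable (integrableS _ _ _ ig) => //.
- by move=> u u01 /=; rewrite fg.
- exact: subset_itv_oc_cc.
Qed.

Lemma eq_Rintegral_unit_segment (f g : R -> R) : measurable_fun setT f ->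
  {in `]0, 1], f =1 g} -> mu.-integrable `[0, 1] (EFin \o g) ->
  \int[mu]_(u in `[0, 1]) f u = \int[mu]_(u in `[0, 1]) g u.
Proof.
move=> mf fg ig; have iS h : mu.-integrable `[0, 1] (EFin \o h) ->
    mu.-integrable `]0, 1] (EFin \o h).
  by apply: integrableS => //; exact: subset_itv_oc_cc.
rewrite -!Rintegral_itv_obnd_cbnd; first last.
- exact/iS/(integrable_unit_segment mf fg ig).
- exact: iS.
exact: eq_Rintegral.
Qed.

Lemma Rintegral_sumZ (D : set (measurableTypeR R)) n (a : 'I_n -> R)
    (h : 'I_n -> R -> R) : measurable D ->
  (forall i, mu.-integrable D (EFin \o h i)) ->
  mu.-integrable D (EFin \o (fun u => \sum_(i < n) a i * h i u)) /\
  \int[mu]_(u in D) (\sum_(i < n) a i * h i u) =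
  \sum_(i < n) a i * \int[mu]_(u in D) h i u.
Proof.
move=> mD ih.
have iah i : mu.-integrable D (fun u => (a i * h i u)%:E).
  exact: (integrableZl mD (a i) (ih i)).
have sumE : EFin \o (fun u => \sum_(i < n) a i * h i u) =
    (fun u => (\sum_(i < n) (a i * h i u)%:E)%E).
  by apply/funext => u /=; rewrite sumEFin.
rewrite sumE; split; first exact: integrable_sum.
rewrite /Rintegral [X in fine X](_ : _ =
    (\sum_(i < n) \int[mu]_(u in D) (a i * h i u)%:E)%E); last first.
  by rewrite -integral_sum//; apply: eq_integral => u _; rewrite sumEFin.
rewrite -sum_fine; last by move=> i _; exact: integrable_fin_num.
by apply: eq_bigr => i _; rewrite -RintegralZl.
Qed.

Lemma power_exp_integrable s c : 0 < s ->
  mu.-integrable `[0, 1] (fun u => (u `^ (s - 1) * expR (- (c * u)))%:E).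
Proof.
move=> s0.
have ig : mu.-integrable `[0, 1] (fun u => (gamma_density s u)%:E).
  have /integrableP[_ ig] : mu.-integrable `]0, 1] (fun u => (gamma_density s u)%:E).
    apply: integrableS (gamma_density_integrable s0) => //.
    by move=> u /=; rewrite !in_itv/= andbT => /andP[].
  have mEg (D : set R) : measurable_fun D (fun u => (gamma_density s u)%:E).
    by apply/measurable_EFinP; exact: measurable_gamma_density.
  apply/integrableP; split; first exact: mEg.
  by rewrite -integral_itv_obnd_cbnd//; exact: measurableT_comp.
(* The majorant is exp(|c| + 1) times the Gamma density: on [0, 1] one has -c u <= |c| <= |c| + 1 -
   u, where the 1 absorbs the exp(-u) of the density. *)
have := integrableZl measurable_unit_segment (expR (`|c| + 1)) ig.
apply: le_integrable => //.
  apply/measurable_EFinP/measurable_funTS/measurable_funM.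
    exact: measurable_powR.
  by apply: measurableT_comp => //; exact: measurable_funN.
move=> u /=; rewrite in_itv/= => /andP[u0 u1].
rewrite lee_fin [leLHS]ger0_norm ?mulr_ge0 ?powR_ge0 ?expR_ge0//.
rewrite [leRHS]ger0_norm ?mulr_ge0 ?powR_ge0 ?expR_ge0//.
rewrite /gamma_density mulrCA ler_wpM2l ?powR_ge0// -expRD ler_expR.
have cu : - (c * u) <= `|c|.
  rewrite (le_trans (ler_norm _))// normrN normrM (ger0_norm u0).
  by rewrite ler_piMr.
by move: cu u1; lra.
Qed.

(** For s > 0 this is Gamma(s) times Tricomi's entire incomplete gamma function at (s, c). It is
    real for c of either sign, so all branch dependence stays in the power in front. *)
Definition lower_gamma_kernel s c : R :=
  \int[mu]_(u in `[0, 1]) (u `^ (s - 1) * expR (- (c * u))).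

Lemma lower_gammaE s z : 0 < s ->
  lower_gamma s z = ppow z s * (lower_gamma_kernel s z)%:C.
Proof.
move=> s0; have [->|z0] := eqVneq z 0.
  rewrite /lower_gamma /cintegral0 lexx set_itv1 /cintegral !Rintegral_set1.
  by rewrite /ppow lexx powR0 ?gt_eqF// mul0r.
rewrite /lower_gamma (@cintegral0_ppow (s - 1) (fun t => expR (- t))).
- by rewrite [z%:C * _]mulrC -ppowD1// subrK.
- by apply: measurableT_comp => //; exact: oppr_measurable.
- exact: power_exp_integrable.
Qed.

End complex_integral.

(** * The reduction formula *)

Section integral_whittaker.
Context {R : realType}.
Implicit Types (b kappa x t u : R) (n m : nat).

Lemma whittakerW_laguerre kappa n t : 0 < kappa ->
  whittakerW (kappa + n%:R) (kappa - 1 / 2) t =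
  ppow t kappa * (expR (- t / 2) * laguerre n (2 * kappa) t)%:C.
Proof.
move=> k0; rewrite /whittakerW.
rewrite (_ : kappa - 1 / 2 + 1 / 2 = kappa); last by rewrite subrK.
rewrite (_ : 1 / 2 + (kappa - 1 / 2) - (kappa + n%:R) = - n%:R); last by field.
rewrite (_ : 1 + 2 * (kappa - 1 / 2) = 2 * kappa); last by field.
rewrite tricomiU_Nnat ?mulr_gt0//.
by rewrite [in RHS]rmorphM mulrA; congr (_ * _); exact: mulrC.
Qed.

Definition laguerre_coef n b m : R :=
  (-1) ^+ n * rising b n * ('C(n, m)%:R * (-1) ^+ m / rising b m).

Lemma laguerreE n b z : laguerre n b z = \sum_(m < n.+1) laguerre_coef n b m * z ^+ m.
Proof.
rewrite /laguerre mulr_sumr; apply: eq_bigr => m _.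
by rewrite /laguerre_coef [(- z) ^+ m]exprNn; ring.
Qed.

(** The identity 1 / t = t (t^2)^(-1) reduces this to real powers; at t = 0 both sides are 0. *)
Lemma measurable_invr : measurable_fun setT (fun t : R => t^-1).
Proof.
rewrite (_ : (fun _ => _) = (fun t => t * (t ^+ 2) `^ (-1))).
  apply: measurable_funM => //.
  by apply: (measurableT_comp (measurable_powR (-1))); exact: measurable_funX.
apply/funext => t; rewrite powR_inv1 ?sqr_ge0//.
have [->|t0] := eqVneq t 0; first by rewrite invr0 mul0r.
by rewrite expr2 invfM mulrA divff// mul1r.
Qed.

Lemma whittakerWi_kernel kappa n x : 0 < kappa ->
  whittakerWi (kappa + n%:R) (kappa - 1 / 2) x = ppow x kappa *
  (\sum_(m < n.+1) laguerre_coef n (2 * kappa) m * x ^+ m *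
     lower_gamma_kernel (kappa + m%:R) (x / 2))%:C.
Proof.
move=> k0; have [->|x0] := eqVneq x 0.
  rewrite /whittakerWi /cintegral0 lexx set_itv1 /cintegral !Rintegral_set1.
  by rewrite /ppow lexx powR0 ?gt_eqF// mul0r.
(* The division by t goes into the real factor, leaving t^kappa as the only complex one. *)
pose r t := expR (- t / 2) * laguerre n (2 * kappa) t / t.
have mr : measurable_fun setT r.
  apply: measurable_funM measurable_invr; apply: measurable_funM.
    apply: measurableT_comp => //.
    by apply: measurable_funM => //; exact: oppr_measurable.
  rewrite (_ : laguerre n (2 * kappa) =
      fun t => \sum_(m < n.+1) laguerre_coef n (2 * kappa) m * t ^+ m).
    by apply: measurable_sum => m; apply: measurable_funM => //; exact: measurable_funX.
  by apply/funext => t; exact: laguerreE.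
have mur : measurable_fun setT (fun u => u `^ kappa * r (x * u)).
  apply: measurable_funM; first exact: measurable_powR.
  by apply: (measurableT_comp mr); exact: mulrl_measurable.
pose h (m : 'I_n.+1) u :=
  u `^ (kappa + m%:R - 1) * expR (- (x / 2 * u)).
(* The factor 1 / x comes from 1 / t at t = x u and will cancel the x produced by the
   substitution. *)
pose a (m : 'I_n.+1) := x^-1 * (laguerre_coef n (2 * kappa) m * x ^+ m).
have mI : measurable (`[0, 1]%classic : set (measurableTypeR R)) by [].
have [ih intE] := Rintegral_sumZ a mI
  (fun m : 'I_n.+1 => @power_exp_integrable R (kappa + m%:R) (x / 2) (ltr_wpDr (ler0n _ _) k0)).
(* The point u = 0 has to be left out: for kappa = 1 the term m = 0 on the right contains 0^0 = 1,
   while the left side is 0. *)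
have rE : {in `]0, 1]%classic,
    (fun u => u `^ kappa * r (x * u)) =1 (fun u => \sum_(m < n.+1) a m * h m u)}.
  move=> u; rewrite inE/= in_itv/= => /andP[u0 _].
  have un0 : u != 0 by rewrite gt_eqF.
  rewrite /r laguerreE mulr_sumr mulr_suml mulr_sumr; apply: eq_bigr => m _.
  rewrite /a /h addrAC powRD ?un0 ?implybT// powR_mulrn ?ltW//.
  rewrite powRB ?un0 ?implybT// powRr1 ?ltW// invfM exprMn.
  rewrite (_ : - (x * u) / 2 = - (x / 2 * u)); last by ring.
  by ring.
have -> : whittakerWi (kappa + n%:R) (kappa - 1 / 2) x =
    cintegral0 (fun t => ppow t kappa * (r t)%:C) x.
  rewrite /whittakerWi; congr cintegral0; apply/funext => t.
  by rewrite whittakerW_laguerre// -mulrA /r -fmorphV -rmorphM.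
rewrite cintegral0_ppow//; last exact: (integrable_unit_segment mur rE ih).
rewrite (eq_Rintegral_unit_segment mur rE ih) intE.
rewrite mulrAC mulrC -rmorphM; congr (_ * _%:C).
rewrite mulr_sumr; apply: eq_bigr => m _.
by rewrite /a mulrA mulVKf.
Qed.

End integral_whittaker.

Theorem theorem32 (R : realType) (n : nat) (kappa : R) (x : R)
    (hkappa : 0 < kappa) :
  whittakerWi (kappa + n%:R) (kappa - 1 / 2) x =
  ((-1) ^+ n * pochhammer (2 * kappa) n * 2 `^ kappa)%:C *
  \sum_(0 <= m < n.+1)
     (('C(n, m)%:R * (-2) ^+ m / pochhammer (2 * kappa) m)%:C *
      lower_gamma (kappa + m%:R) (x / 2)).
Proof.
have b0 i : 2 * kappa + i%:R != 0 :> R.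
  by rewrite gt_eqF// ltr_wpDr// mulr_gt0.
rewrite whittakerWi_kernel// pochhammerE// big_mkord.
(* At x = 0 every term carries a positive power of 0, so both sides vanish; splitting the exponent
   kappa + m below needs a nonzero base. *)
have [->|x0] := eqVneq x 0.
  rewrite /ppow lexx powR0 ?gt_eqF// mul0r big1 ?mulr0// => m _.
  rewrite lower_gammaE ?ltr_wpDr// mul0r /ppow lexx powR0 ?mul0r ?mulr0//.
  by rewrite gt_eqF// ltr_wpDr.
rewrite rmorph_sum/= !mulr_sumr; apply: eq_bigr => m _.
rewrite lower_gammaE ?ltr_wpDr// ppowDn ?mulf_neq0 ?invr_eq0//.
rewrite [x / 2]mulrC ppowM ?invr_ge0//.
rewrite pochhammerE//; set G := lower_gamma_kernel _ _.
(* The power x^kappa is now the only non-real factor, so what remains is an identity of real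
   coefficients. *)
transitivity (ppow x kappa * ((-1) ^+ n * rising (2 * kappa) n * 2 `^ kappa *
   ('C(n, m)%:R * (-2) ^+ m / rising (2 * kappa) m) *
   ((2^-1) `^ kappa * (2^-1 * x) ^+ m * G))%:C); last by rewrite !rmorphM; ring.
congr (_ * _%:C); rewrite /laguerre_coef.
(* The prefactor 2^kappa cancels the scaling of (x / 2)^kappa, and (-2)^m that of (x / 2)^m. *)
have half : 2 `^ kappa * (2^-1) `^ kappa = 1 :> R.
  by rewrite -powRM ?invr_ge0// divff// powR1.
have pow2 : (-2) ^+ m * (2^-1 * x) ^+ m = (-1) ^+ m * x ^+ m.
  by rewrite -!exprMn mulrA mulNr divff.
transitivity ((-1) ^+ n * rising (2 * kappa) n * 'C(n, m)%:R /
  rising (2 * kappa) m * G * ((-1) ^+ m * x ^+ m)); first by ring.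
rewrite -pow2 -[LHS]mulr1 -[X in _ * X = _]half; ring.
Qed.
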